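(* Assume $\mathfrak u<\mathfrak g$. Then every paracompact hereditarily Lindelöf topological space $X$ with the property $\mathrm{Split}(\Lambda,\Lambda)$ has the Hurewicz property.
   Context: A large open cover of a topological space $X$ is a family $u$ of open subsets of $X$ such that every $x\in X$ belongs to infinitely many $U\in u$; $\Lambda(X)$ is the family of all large open covers of $X$. $X$ has the property $\mathrm{Split}(\Lambda,\Lambda)$ if for every $u\in\Lambda(X)$ there are $v_1,v_2\in\Lambda(X)$ with $v_1\cap v_2=\emptyset$ and $v_1\cup v_2\subset u$. For a family $u$ of subsets of $X$, a set $B\subset X$ is $u$-bounded if $B\subset\bigcup v$ for some finite $v\subset u$. $X$ has the Hurewicz property if for every sequence $(u_n)_{n\in\omega}$ of open covers of $X$ there is a sequence $(B_n)_{n\in\omega}$ of subsets of $X$ such that each $B_n$ is $u_n$-bounded and $\{B_n:n\in\omega\}$ is a $\gamma$-cover of $X$, i.e. for every $x\in X$ the set $\{n\in\omega:x\notin B_n\}$ is finite. $\mathfrak u$ is the smallest cardinality of a base of a nonprincipal ultrafilter on $\omega$. The cardinal $\mathfrak g$: let $C$ be a countably infinite set and let $[C]^{\aleph_0}$ be the set of its infinite subsets. Write $A\subset^\ast B$ if $A\setminus B$ is finite. A family $\mathcal D\subset[C]^{\aleph_0}$ is open if $A\in\mathcal D$ whenever $A\in[C]^{\aleph_0}$ and $A\subset^\ast B$ for some $B\in\mathcal D$. An open family $\mathcal D$ is groupwise dense if for every infinite collection $\Pi$ of finite pairwise disjoint subsets of $C$ there is an infinite $\mathcal H\subset\Pi$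 with $\bigcup\mathcal H\in\mathcal D$. Then $\mathfrak g$ is the smallest cardinality of a collection of groupwise dense families with empty intersection. *)

(* Defs.v *)
From mathcomp Require Import all_boot all_classical topology.

Set Implicit Arguments.
Unset Strict Implicit.
Unset Printing Implicit Defensive.

Local Open Scope classical_set_scope.
Local Open Scope card_scope.

(** Covering properties.  Families of subsets of [X] are sets of sets, so they
    carry no repetitions. *)

Definition open_cover (X : topologicalType) (u : set (set X)) : Prop :=
  u `<=` open /\ \bigcup_(U in u) U = setT.

Definition large_open_cover (X : topologicalType) (u : set (set X)) : Prop :=
  u `<=` open /\ forall x : X, infinite_set [set U | u U /\ U x].

Definition split_large (X : topologicalType) : Prop :=
  forall u : set (set X), large_open_cover u ->
  exists v1 v2 : set (set X),
    [/\ large_open_cover v1, large_open_cover v2,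
        v1 `&` v2 = set0 & v1 `|` v2 `<=` u].

Definition bounded_by (X : Type) (u : set (set X)) (B : set X) : Prop :=
  exists v : set (set X),
    [/\ finite_set v, v `<=` u & B `<=` \bigcup_(V in v) V].

Definition hurewicz (X : topologicalType) : Prop :=
  forall u : nat -> set (set X), (forall n, open_cover (u n)) ->
  exists B : nat -> set X,
    (forall n, bounded_by (u n) (B n)) /\
    (forall x : X, finite_set [set n | ~ B n x]).

Definition lindelof (X : topologicalType) : Prop :=
  forall u : set (set X), open_cover u ->
  exists v : set (set X), [/\ countable v, v `<=` u & open_cover v].

(* [set_type A] carries the subspace topology. *)
Definition hereditarily_lindelof (X : topologicalType) : Prop :=
  forall A : set X, lindelof (set_type A).

Definition locally_finite (X : topologicalType) (v : set (set X)) : Prop :=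
  forall x : X, exists2 N : set X,
    nbhs x N & finite_set [set V | v V /\ V `&` N !=set0].

Definition refines (X : Type) (v u : set (set X)) : Prop :=
  forall V, v V -> exists2 U, u U & V `<=` U.

(* Paracompact spaces are Hausdorff by definition (Dieudonne, Engelking). *)
Definition paracompact (X : topologicalType) : Prop :=
  hausdorff_space X /\
  forall u : set (set X), open_cover u ->
  exists v : set (set X), [/\ open_cover v, refines v u & locally_finite v].

(** Small cardinals.  A cardinal defined as the least cardinality of the members
    of a class [K] of sets is represented by any member of [K] realizing it. *)

Definition least_card (T : Type) (K : set (set T)) (A : set T) : Prop :=
  K A /\ forall B, K B -> A #<= B.

Definition nonprincipal_ultrafilter (C : Type) (F : set_system C) : Prop :=
  UltraFilter F /\ forall c : C, F <> principal_filter c.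

Definition ultrafilter_base (C : Type) (B : set (set C)) : Prop :=
  exists2 F : set_system C,
    nonprincipal_ultrafilter F & F = filter_from B id.

Definition almost_subset (C : Type) (A B : set C) : Prop :=
  finite_set (A `\` B).

Definition open_family (C : Type) (D : set (set C)) : Prop :=
  D `<=` [set A | infinite_set A] /\
  forall A B : set C, infinite_set A -> D B -> almost_subset A B -> D A.

Definition groupwise_dense (C : Type) (D : set (set C)) : Prop :=
  open_family D /\
  forall P : set (set C),
    infinite_set P -> (forall p, P p -> finite_set p) -> trivIset P id ->
    exists H : set (set C),
      [/\ infinite_set H, H `<=` P & D (\bigcup_(h in H) h)].

(* The intersection over the empty collection is [setT], so an empty [G] does
   not qualify. *)
Definition groupwise_dense_collection (C : Type) (G : set (set (set C))) : Prop :=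
  (forall D, G D -> groupwise_dense D) /\ \bigcap_(D in G) D = set0.

Definition u_lt_g : Prop :=
  exists (B : set (set nat)) (G : set (set (set nat))),
    [/\ least_card (@ultrafilter_base nat) B,
        least_card (@groupwise_dense_collection nat) G,
        B #<= G & ~ (G #<= B)].

(* Main.v *)
Require Import Defs.
From mathcomp Require Import all_boot all_classical topology.
From mathcomp Require Import zify.

(** Call a set [T] good for the sequence [u] of covers when its points satisfy the
    Hurewicz condition for [u]. Countable unions of good sets are good, so in a
    hereditarily Lindelöf space there is a largest good open set [O]; one has to
    show that it is the whole space. Otherwise a large cover that cannot be split
    is built as follows.

    By paracompactness the space has an enumerated open cover [R] whose sets are
    colored so that sets of equal color are disjoint, sets of color at least [m]
    are bounded by [u m], and each point is in infinitely many sets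
    ([colored_cover_exists]). Two disjoint families per cover suffice, namely the
    rings of even and of odd index around an exhausting chain of open sets. The
    point of the coloring is a pigeonhole argument: if some interval partition of
    the indices is such that each point of [T] is met by [R] on almost all of the
    intervals, then the number of intervals to wait until a large color shows up
    does not depend on the point, and [T] is good ([colored_cover_hurewicz_on]).
    A merely locally finite cover gives no such uniform bound.

    The complement of [O] is not good, hence the index sets [set i | R i x], for
    [x] outside [O], evade interval partitions: for each partition, one of these
    sets misses infinitely many intervals. So they generate a nonmeager semifilter.
    When an ultrafilter has a base smaller than [g], every nonmeager semifilter has
    an image under a finite-to-one monotone map that contains the image of the
    ultrafilter ([u_lt_g_swallowing]). Glue the sets [R i] along the fibers of that map and
    add [O] to each of the resulting sets. By maximality of [O] a set occurs only
    finitely often among these, unless it is contained in [O], so they form a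
    large cover; and the indices of a large subfamily form a member of the
    ultrafilter, so two large subfamilies are never disjoint
    ([split_large_hurewicz_on]). *)

Set Implicit Arguments.
Unset Strict Implicit.
Unset Printing Implicit Defensive.

Local Open Scope classical_set_scope.
Local Open Scope nat_scope.

(** * Infinite sets of natural numbers and interval partitions *)

Lemma finite_nat_boundedP (A : set nat) :
  finite_set A <-> exists N, forall n, A n -> n < N.
Proof.
split=> [/finite_seqP[s ->]|[N AN]]; last first.
  by apply: sub_finite_set (finite_II N) => n /AN.
exists (\max_(i <- s) i).+1 => n /= ns; rewrite ltnS.
by rewrite (big_rem n) //= leq_max leqnn.
Qed.

Lemma infinite_nat_unboundedP (A : set nat) :
  infinite_set A <-> forall N, exists2 n, A n & N <= n.
Proof.
split=> [infA N|unbA /finite_nat_boundedP[N AN]].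
  apply: contrapT => noA; apply: infA; apply/finite_nat_boundedP; exists N => n An.
  by rewrite ltnNge; apply/negP => Nn; apply: noA; exists n.
by have [n /AN] := unbA N; rewrite ltnNge => /negP.
Qed.

Lemma interval_chain (Q : nat -> nat -> Prop) :
  (forall m, exists n, m < n /\ Q m n) ->
  exists2 a : nat -> nat, (forall j, a j < a j.+1) & forall j, Q (a j) (a j.+1).
Proof.
move=> step; have [next nextP] := choice step.
by exists (fun j => iter j next 0) => j; have [] := nextP (iter j next 0).
Qed.

Lemma increasing_le (a : nat -> nat) i j :
  (forall j, a j < a j.+1) -> i <= j -> a i <= a j.
Proof.
move=> incr; elim: j => [|j IHj]; first by rewrite leqn0 => /eqP ->.
rewrite leq_eqVlt => /orP[/eqP-> //|]; rewrite ltnS => /IHj.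
by move/leq_trans; apply; apply: ltnW.
Qed.

Lemma increasing_interval (a : nat -> nat) i :
  (forall j, a j < a j.+1) -> a 0 <= i -> exists j, a j <= i < a j.+1.
Proof.
move=> incr a0i.
have lt_a j : j <= a j by elim: j => // j IHj; apply: leq_ltn_trans IHj (incr j).
have bnd j : a j <= i -> j <= i by apply: leq_trans.
have [j aj jmax] := ex_maxnP (ex_intro (fun j => a j <= i) 0 a0i) bnd.
by exists j; rewrite aj ltnNge; apply/negP => /jmax; rewrite ltnn.
Qed.

Lemma increasing_interval_inj (a : nat -> nat) i j k :
  (forall j, a j < a j.+1) -> a j <= i < a j.+1 -> a k <= i < a k.+1 -> j = k.
Proof.
move=> incr /andP[aj ja] /andP[ak ka].
case: (ltngtP j k) => // [/(increasing_le incr)|/(increasing_le incr)]; lia.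
Qed.

(** * Ultrafilters below groupwise density *)

(** Up to closing [SS] under almost-supersets, this says that [SS] is not
    meager: by Talagrand and Jalali-Naini, a meager upward closed family is one
    whose members meet almost all intervals of some interval partition. *)
Definition evades_intervals (SS : set (set nat)) : Prop :=
  forall a : nat -> nat, (forall j, a j < a j.+1) ->
  exists2 S, SS S &
    forall N, exists2 j, N <= j & forall i, a j <= i < a j.+1 -> ~ S i.

(** The maps [cut A] are the interval partitions in disguise: two numbers have
    the same image when no element of [A] separates them. *)
Definition cut (A : set nat) (i : nat) : set nat := A `&` [set a | a <= i].

Lemma cut_fiber_bounded (A : set nat) : infinite_set A ->
  forall i, exists b, forall i', cut A i' = cut A i -> i' < b.
Proof.
move=> /infinite_nat_unboundedP infA i; have [a Aa ia] := infA i.+1.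
exists a => i' eqc; rewrite ltnNge; apply/negP => ai'.
have : cut A i' a by split.
by rewrite eqc => -[_ /=]; rewrite leqNgt ia.
Qed.

Lemma eq_cut (A : set nat) m n i i' :
  (forall k, m <= k < n -> ~ A k) -> m <= i < n -> m <= i' < n ->
  cut A i = cut A i'.
Proof.
move=> noA ii ii'; apply/seteqP; split=> k [Ak /= ki]; split=> //=.
- by case: (leqP m k) => mk; [case: (noA k) => //; lia|lia].
- by case: (leqP m k) => mk; [case: (noA k) => //; lia|lia].
Qed.

(** As the fibers of [cut A] are finite, this says that the image of [E] under
    [cut A] contains almost all of the image of a member of [SS]. *)
Definition cut_swallows (SS : set (set nat)) (E : set nat) : set (set nat) :=
  [set A | infinite_set A /\ exists2 S, SS S &
    finite_set [set i | S i /\ forall e, E e -> cut A e <> cut A i]].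

(** Removing elements from [A] makes the pieces larger, and finitely many new
    elements only affect an initial segment. *)
Lemma cut_swallows_open SS E : open_family (cut_swallows SS E).
Proof.
split=> [A []//|A A' infA [infA' [S SSS finS]] /finite_nat_boundedP[M AM]].
split=> //; exists S => //.
have [m A'm Mm] := (infinite_nat_unboundedP A').1 infA' M.
apply: sub_finite_set (_ : _ `<=`
  `I_m `|` [set i | S i /\ forall e, E e -> cut A' e <> cut A' i]) _; last first.
  by rewrite finite_setU; split=> //; exact: finite_II.
move=> i [Si noE]; have [im|mi] := ltnP i m; [by left|right; split=> // e Ee eqc].
apply: (noE e Ee).
have me : m <= e.
  have : cut A' i m by split.
  by rewrite -eqc => -[].
have A'lt k : A k -> m <= k -> A' k.
  move=> Ak mk; apply: contrapT => nA'k.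
  by have := AM k (conj Ak nA'k); lia.
apply/seteqP; split=> k [Ak /= ke]; split=> //=.
- have [km|mk] := ltnP k m; first lia.
  have : cut A' e k by split=> //; exact: A'lt.
  by rewrite eqc => -[].
- have [km|mk] := ltnP k m; first lia.
  have : cut A' i k by split=> //; exact: A'lt.
  by rewrite -eqc => -[].
Qed.

Lemma disjoint_member_above (P : set (set nat)) (m : nat) :
  infinite_set P -> trivIset P id ->
  exists p, [/\ P p, p !=set0 & forall i, p i -> m <= i].
Proof.
move=> infP trivP; apply: contrapT => noP; apply: infP.
have hits p : P p -> p !=set0 -> exists i, p i /\ i < m.
  move=> Pp p0; apply: contrapT => noi; apply: noP; exists p; split=> // i pi.
  by rewrite leqNgt; apply/negP => im; apply: noi; exists i.
(* A number belongs to at most one member of [P], its owner. *)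
pose owner i : set nat := xget set0 [set p | P p /\ p i].
apply: sub_finite_set (_ : _ `<=` [set set0] `|` owner @` `I_m) _; last first.
  rewrite finite_setU; split; first exact: finite_set1.
  exact/finite_image/finite_II.
move=> p Pp; have [->|/set0P p0] := eqVneq p set0; [by left|right].
have [i [pi im]] := hits p Pp p0; exists i => //.
rewrite /owner; case: xgetP => [q _ [Pq qi]|/(_ p)]; last by case; split.
by apply: (trivP) => //; exists i; split.
Qed.

(** From the given finite sets extract a sequence [p] lying in consecutive
    intervals, each of which also contains a point of [E].  Some [S] in [SS]
    misses infinitely many of these intervals; the union of the corresponding
    [p j] leaves every interval met by [S] uncut, so that each point of [S] is
    in the same piece as a point of [E]. *)
Lemma cut_swallows_groupwise_dense SS E :
  evades_intervals SS -> infinite_set E -> groupwise_dense (cut_swallows SS E).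
Proof.
move=> evSS /infinite_nat_unboundedP infE; split=> [|P infP finP trivP].
  exact: cut_swallows_open.
pose good m n := exists p, [/\ P p, p !=set0, (forall i, p i -> m <= i < n) &
  exists2 e, E e & m <= e < n].
have [a incr /choice[p pP]] : exists2 a : nat -> nat,
    (forall j, a j < a j.+1) & forall j, good (a j) (a j.+1).
  apply: interval_chain => m.
  have [p [Pp p0 mp]] := disjoint_member_above m infP trivP.
  have [N pN] := (finite_nat_boundedP p).1 (finP p Pp).
  have [e Ee me] := infE m.
  exists (maxn N e.+1); split; first by rewrite leq_max ltnS me orbT.
  exists p; split=> //; last by exists e => //; rewrite me leq_max ltnSn orbT.
  by move=> i pi; rewrite mp //= leq_max pN.
have pint j i : p j i -> a j <= i < a j.+1 by have [_ _ h _] := pP j; apply: h.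
have [S SSS missS] := evSS a incr.
pose K := [set j | forall i, a j <= i < a j.+1 -> ~ S i].
have infK : infinite_set K.
  by apply/infinite_nat_unboundedP => N; have [j] := missS N; exists j.
have p_inj j k i : p j i -> p k i -> j = k.
  by move=> /pint pj /pint; exact: increasing_interval_inj incr pj.
exists (p @` K); split.
- apply: contra_not infK => finpK.
  pose back q : nat := xget 0 [set j | K j /\ p j = q].
  apply: sub_finite_set (finite_image back finpK) => j Kj.
  exists (p j); first by exists j.
  rewrite /back; case: xgetP => [k _ [_ eqp]|/(_ j)]; last by case.
  have [_ [i pi] _ _] := pP j.
  by apply: (p_inj _ _ i) => //; rewrite eqp.
- by move=> _ [j _ <-]; have [] := pP j.
split.
  apply/infinite_nat_unboundedP => N.
  have [j Kj Nj] := (infinite_nat_unboundedP K).1 infK N.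
  have [_ [i pi] _ _] := pP j; exists i; first by exists (p j) => //; exists j.
  have aj : j <= a j.
    by elim: (j) => // k IHk; apply: leq_ltn_trans IHk (incr k).
  by have := pint _ _ pi; lia.
exists S => //; apply: sub_finite_set (finite_II (a 0)) => i [Si noE] /=.
rewrite ltnNge; apply/negP => a0i.
have [j iint] := increasing_interval incr a0i.
have [_ _ _ [e Ee eint]] := pP j.
apply: (noE e Ee); apply: (eq_cut _ eint iint) => k kint [_ [l Kl <-] plk].
have ejl := increasing_interval_inj incr kint (pint _ _ plk).
by move: Kl; rewrite -ejl => /(_ i iint).
Qed.

Lemma nonprincipal_infinite (F : set_system nat) E :
  nonprincipal_ultrafilter F -> F E -> infinite_set E.
Proof.
move=> [UF npF] FE.
have PF : ProperFilter F by exact: ultra_proper.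
have no1 c : F (~` [set c]).
  have [Fc|//] := in_ultra_setVsetC [set c] UF; exfalso.
  apply: (npF c); apply/seteqP; split=> A.
  - move=> FA; apply/principal_filterP.
    by have [_ [-> ]] := filter_ex (filterI Fc FA).
  - by move=> /principal_filterP Ac; apply: filterS Fc => _ ->.
have tail N : F [set n | N <= n].
  elim: N => [|N IHN]; first by apply: filterS FE.
  apply: filterS (filterI IHN (no1 N)) => n [/= Nn /eqP nN].
  by rewrite ltn_neqAle eq_sym nN.
move=> /finite_nat_boundedP[N EN].
have [n [/EN]] := filter_ex (filterI FE (tail N)).
by rewrite /= ltnNge => /negP.
Qed.

(** Fewer than [g] groupwise dense families have a common member [A]; apply this
    to the families [cut_swallows SS E] for [E] in a base of an ultrafilter of
    size less than [g].  Thus the image under [cut A] of the family of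
    almost-supersets of members of [SS] contains the image of the ultrafilter. *)
Lemma u_lt_g_swallowing : u_lt_g ->
  exists2 F : set_system nat, UltraFilter F &
  forall SS : set (set nat), evades_intervals SS ->
  exists2 A, infinite_set A & forall E, F E ->
    exists2 S, SS S &
      finite_set [set i | S i /\ forall e, E e -> cut A e <> cut A i].
Proof.
move=> [B [G [[[F npF eqF] _] [_ leastG] _ nGB]]].
exists F; first by case: npF.
move=> SS evSS.
have BF E : B E -> F E by move=> BE; rewrite eqF; exists E.
have [A Acap] : \bigcap_(D in cut_swallows SS @` B) D !=set0.
  apply/set0P/eqP => cap0; apply: nGB.
  apply: card_le_trans (card_image_le (cut_swallows SS) B).
  apply: leastG; split=> // _ [E BE <-].
  apply: cut_swallows_groupwise_dense => //.
  by apply: nonprincipal_infinite npF _; exact: BF.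
have FT : F setT by case: npF => UF _; exact: filterT.
have swA E : B E -> cut_swallows SS E A by move=> BE; apply: Acap; exists E.
exists A.
  by move: FT; rewrite eqF => -[E BE _]; have [] := swA E BE.
move=> E; rewrite eqF => -[E' BE' E'E].
have [_ [S SSS finS]] := swA E' BE'; exists S => //.
by apply: sub_finite_set finS => i [Si noE]; split=> // e /E'E; exact: noE.
Qed.

(** * Lindelöf and paracompact spaces *)

Lemma hereditarily_lindelof_bigcup (X : topologicalType) (g : set (set X)) :
  hereditarily_lindelof X -> g `<=` open -> g set0 ->
  exists2 e : nat -> set X, (forall n, g (e n)) &
    \bigcup_(U in g) U = \bigcup_n e n.
Proof.
move=> hlX gop g0; pose A := \bigcup_(U in g) U.
pose trace (U : set X) : set (set_type A) := set_val @^-1` U.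
have [|v [/countable_injP[f finj] vg [_ vT]]] := hlX A (trace @` g).
  split=> [_ [U gU <-]|].
    by apply: open_comp (gop U gU) => x _; exact: initial_continuous.
  apply/seteqP; split=> // x _; have [U gU Ux] := set_valP x.
  by exists (trace U) => //; exists U.
pose e n := xget set0 [set U | [/\ g U, v (trace U) & f (trace U) = n]].
have ge n : g (e n) by rewrite /e; case: xgetP => [U _ []|_].
exists e => //; apply/seteqP; split=> x.
  move=> Ax; have : (\bigcup_(U in v) U) (exist _ x (mem_set Ax)) by rewrite vT.
  move=> [_ /[dup] /vg[U gU <-] /= vU Ux]; exists (f (trace U)) => //.
  rewrite /e; case: xgetP => [U' _ [_ vU' eqf]|/(_ U)]; last by case.
  have eqU : trace U' = trace U by apply: finj; rewrite ?inE.
  suff : trace U' (exist _ x (mem_set Ax)) by [].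
  by rewrite eqU.
by move=> [n _ ex]; exists (e n).
Qed.

(** A locally finite open refinement of the cover by the complement of [C] and
    the open sets with closure disjoint from [D]: the union [W] of its members
    that meet [C] works, as closure commutes with locally finite unions. *)
Lemma paracompact_separation (X : topologicalType) (C D : set X) :
  paracompact X -> closed C ->
  (forall c, C c -> exists N : set X, [/\ open N, N c & closure N `&` D = set0]) ->
  exists W : set X, [/\ open W, C `<=` W & closure W `&` D = set0].
Proof.
move=> [_ paraX] clC sepC.
pose u := [set N : set X | open N /\ (closure N `&` D = set0 \/ N `&` C = set0)].
have [|v [[vop vT] vu lfv]] := paraX u.
  split=> [N []//|]; apply/seteqP; split=> // x _.
  have [/sepC[N [oN Nx ND]]|nCx] := pselect (C x).
    by exists N => //; split=> //; left.
  exists (~` C) => //; split; first exact: closed_openC.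
  by right; rewrite setICl.
pose w := [set V | v V /\ V `&` C !=set0].
exists (\bigcup_(V in w) V); split.
- by apply: bigcup_open => V [/vop].
- move=> c Cc; have : (\bigcup_(V in v) V) c by rewrite vT.
  by move=> [V vV Vc]; exists V => //; split=> //; exists c.
apply/seteqP; split=> // x [clWx Dx].
have [N nbN finN] := lfv x.
pose wN := w `&` [set V | V `&` N !=set0].
have clF : closed (\bigcup_(V in wN) closure V).
  apply: closed_bigcup => [|V _]; last exact: closed_closure.
  by apply: sub_finite_set finN => V [[vV _] VN].
have nFx : ~ (\bigcup_(V in wN) closure V) x.
  move=> [V [[vV [c [Vc Cc]]] _] clVx].
  have [U [_ [UD|UC]] VU] := vu V vV.
    by suff : set0 x by []; rewrite -UD; split=> //; exact: closure_subset VU _ clVx.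
  by suff : set0 c by []; rewrite -UC; split=> //; exact: VU.
have nbF : nbhs x (~` \bigcup_(V in wN) closure V).
  by apply: open_nbhs_nbhs; split=> //; exact: closed_openC.
have [y [[V wV Vy] [Ny]]] := clWx _ (filterI nbN nbF).
apply; exists V; last exact: subset_closure.
by split=> //; exists y.
Qed.

Lemma paracompact_shrink_point (X : topologicalType) (x : X) (O : set X) :
  paracompact X -> open O -> O x ->
  exists N : set X, [/\ open N, N x & closure N `<=` O].
Proof.
move=> paraX oO Ox; have [hausX _] := paraX.
have [|c nOc|W [oW OW Wx]] := paracompact_separation (C := ~` O) (D := [set x]) paraX.
- exact: open_closedC.
- have cx : c != x by apply/eqP => cx; apply: nOc; rewrite cx.
  move: hausX; rewrite open_hausdorff => /(_ c x cx)[[A B] /= [cA xB] [oA oB /eqP AB]].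
  exists A; split=> //; first exact: set_mem.
  apply/seteqP; split=> // x' [clAx eqx].
  have [|y [Ay By]] := clAx B; first rewrite eqx.
    by apply: open_nbhs_nbhs; split=> //; exact: set_mem.
  by suff : set0 y by []; rewrite -AB.
exists (~` closure W); split.
- by apply: closed_openC; exact: closed_closure.
- by move=> clWx; suff : set0 x by []; rewrite -Wx.
have clCW : closed (~` W) by exact: open_closedC.
apply: (@subset_trans _ (~` W)); last by move=> y nWy; apply: contrapT => /OW.
rewrite [X in _ `<=` X]((closure_id _).1 clCW); apply: closure_subset.
by apply: subsetC; exact: subset_closure.
Qed.

Lemma paracompact_shrink (X : topologicalType) (C O : set X) :
  paracompact X -> closed C -> open O -> C `<=` O ->
  exists G : set X, [/\ open G, C `<=` G & closure G `<=` O].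
Proof.
move=> paraX clC oO CO.
have [c /CO Oc|G [oG CG GO]] :=
    paracompact_separation (D := ~` O) paraX clC.
  have [N [oN Nc NO]] := paracompact_shrink_point paraX oO Oc.
  by exists N; split=> //; apply/disjoints_subset; rewrite setCK.
by exists G; split=> //; move/disjoints_subset: GO; rewrite setCK.
Qed.

(** Cover the space by open sets [V n] with closure in a member of [g]. Given
    [G k], shrink the union of the first [k + 1] of these members to an open set
    [G k.+1] that still contains the closures of [G k] and [V k]. *)
Lemma paracompact_open_chain (X : topologicalType) (g : set (set X)) :
  paracompact X -> hereditarily_lindelof X ->
  g `<=` open -> g set0 -> (forall U V, g U -> g V -> g (U `|` V)) ->
  \bigcup_(U in g) U = setT ->
  exists G : nat -> set X,
    [/\ G 0 = set0, forall k, open (G k), forall k, closure (G k) `<=` G k.+1,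
        forall k, exists2 U, g U & G k `<=` U & \bigcup_k G k = setT].
Proof.
move=> paraX hlX gop g0 gU gT.
pose h := [set N : set X | open N /\ exists2 U, g U & closure N `<=` U].
have [|| V hV] := hereditarily_lindelof_bigcup (g := h) hlX; first by move=> N [].
  by split; [exact: open0|exists set0 => //; rewrite closure0].
have -> : \bigcup_(U in h) U = setT.
  apply/seteqP; split=> // x _; have : (\bigcup_(U in g) U) x by rewrite gT.
  move=> [U /[dup] gU' /gop oU Ux].
  have [N [oN Nx NU]] := paracompact_shrink_point paraX oU Ux.
  by exists N => //; split=> //; exists U.
move=> VT; have [U UP] := choice (fun n => (exists2P _ _).1 (hV n).2).
pose O k := \bigcup_(n in `I_k) U n.
have OS k : O k.+1 = U k `|` O k by rewrite /O IIS bigcup_setU bigcup_set1 setUC.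
have gO k : g (O k).
  elim: k => [|k IHk]; first by rewrite /O II0 bigcup_set0.
  by rewrite OS; apply: gU IHk; case: (UP k).
pose shrinks (CO : set X * set X) G :=
  closed CO.1 -> open CO.2 -> CO.1 `<=` CO.2 ->
  [/\ open G, CO.1 `<=` G & closure G `<=` CO.2].
have [[C O'] /=|sh shP] := @choice _ _ shrinks.
  have [[clC oO CO]|nCO] := pselect [/\ closed C, open O' & C `<=` O'].
    by have [G ?] := paracompact_shrink paraX clC oO CO; exists G.
  by exists set0 => ? ? ?; case: nCO.
pose G := fix G k := if k is k'.+1
  then sh (closure (G k') `|` closure (V k'), O k'.+1) else set0.
have step k : closure (G k) `<=` O k ->
    [/\ open (G k.+1), closure (G k) `|` closure (V k) `<=` G k.+1
      & closure (G k.+1) `<=` O k.+1].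
  move=> GO; apply: shP => /=.
  - by apply: closedU; exact: closed_closure.
  - exact: gop.
  - by rewrite OS subUset; split=> x; [move=> /GO; right|move=> /((UP k).2); left].
have GO k : closure (G k) `<=` O k.
  by elim: k => [|k /step[]//]; rewrite closure0.
have GS k := step k (GO k).
exists G; split=> // [k|k|k|].
- by case: k => [|k]; [exact: open0|have [] := GS k].
- by have [_] := GS k; rewrite subUset => -[].
- by exists (O k) => // x /subset_closure /GO.
apply/seteqP; split=> // x _; have : (\bigcup_n V n) x by rewrite -VT.
move=> [n _ Vx]; exists n.+1 => //; have [_] := GS n; rewrite subUset => -[_].
by move=> + _; apply; exact: subset_closure.
Qed.

(** The rings [G k.+2 `\` closure (G k)] of an exhausting chain [G] cover the
    space, and two of them are disjoint unless their indices are equal or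
    adjacent; so the rings of even index and those of odd index form two disjoint
    families. *)
Lemma paracompact_two_disjoint_families (X : topologicalType) (g : set (set X)) :
  paracompact X -> hereditarily_lindelof X ->
  g `<=` open -> g set0 -> (forall U V, g U -> g V -> g (U `|` V)) ->
  \bigcup_(U in g) U = setT ->
  exists R : bool -> nat -> set X,
    [/\ forall b k, open (R b k), forall b k, exists2 U, g U & R b k `<=` U,
        forall b k l x, R b k x -> R b l x -> k = l
      & forall x, exists b k, R b k x].
Proof.
move=> paraX hlX gop g0 gU gT.
have [G [G0 oG clG gG GT]] := paracompact_open_chain paraX hlX gop g0 gU gT.
have subG k l : k <= l -> G k `<=` G l.
  elim: l => [|l IHl]; first by rewrite leqn0 => /eqP ->.
  rewrite leq_eqVlt => /orP[/eqP-> //|]; rewrite ltnS => /IHl kl x /kl /subset_closure.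
  exact: clG.
pose ring k := G k.+2 `\` closure (G k).
exists (fun b k => ring (k.*2 + b)); split=> [b k|b k|b k l x|x].
- by rewrite /ring setDE; apply: openI => //; apply: closed_openC; exact: closed_closure.
- by have [U gU' GU] := gG (k.*2 + b).+2; exists U => // x [/GU].
- have far k' l' : k'.+2 <= l' -> ring k' x -> ~ ring l' x.
    by move=> kl [/(subG _ _ kl) Gx _] [_]; apply; exact: subset_closure.
  move=> kx lx; case: (ltngtP k l) => // kl.
  + by case: (far _ _ _ kx lx); lia.
  + by case: (far _ _ _ lx kx); lia.
have [k ring_x] : exists k, ring k x.
  have [k Gkx kmin] : exists2 k, G k x & forall l, G l x -> k <= l.
    have : exists k, `[< G k x >].
      have : (\bigcup_k G k) x by rewrite GT.
      by move=> [k _ Gx]; exists k; exact/asboolP.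
    move=> /ex_minnP[k /asboolP Gx kmin]; exists k => // l /asboolP; exact: kmin.
  exists k.-2; split; first by apply: subG Gkx; lia.
  case: k Gkx kmin => [|[|k]]; [by rewrite G0|by rewrite /= G0 closure0 => _ _ []|].
  by move=> _ kmin /clG /kmin /=; rewrite ltnn.
by exists (odd k), k./2; rewrite addnC odd_double_half.
Qed.

(** * Subsets covered by bounded sets *)

Lemma bounded_byS (T : Type) (u : set (set T)) (A B : set T) :
  A `<=` B -> bounded_by u B -> bounded_by u A.
Proof. by move=> AB [v [finv vu Bv]]; exists v; split=> //; exact: subset_trans Bv. Qed.

Lemma bounded_by_bigcup (T I : Type) (u : set (set T)) (D : set I) (B : I -> set T) :
  finite_set D -> (forall i, D i -> bounded_by u (B i)) ->
  bounded_by u (\bigcup_(i in D) B i).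
Proof.
move=> finD bB; have [i0|v vP] := @choice _ _ (fun i v => D i ->
    [/\ finite_set v, v `<=` u & B i `<=` \bigcup_(V in v) V]).
  by have [/bB[v ?]|nD] := pselect (D i0); [exists v|exists set0].
exists (\bigcup_(i in D) v i); split=> [|V [i Di viV]|x [i Di Bix]].
- by apply: bigcup_finite => // i /vP[].
- by have [_ vu _] := vP i Di; exact: vu.
- by have [_ _ /(_ x Bix)[V viV Vx]] := vP i Di; exists V => //; exists i.
Qed.

Lemma bounded_by0 (T : Type) (u : set (set T)) : bounded_by u set0.
Proof. by exists set0; split=> //; exact: finite_set0. Qed.

Lemma bounded_byU (T : Type) (u : set (set T)) (A B : set T) :
  bounded_by u A -> bounded_by u B -> bounded_by u (A `|` B).
Proof.
move=> bA bB; rewrite -bigcup2E; apply: bounded_byS (_ : bounded_by u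
  (\bigcup_(i in `I_2) bigcup2 A B i)).
  move=> x [[|[|i]] _] //= ?; [by exists 0|by exists 1].
apply: bounded_by_bigcup (finite_II 2) _ => -[|[|i]] //= _.
Qed.

(** The Hurewicz condition for the points of [T] and the single sequence [u]. *)
Definition hurewicz_on (X : Type) (u : nat -> set (set X)) (T : set X) : Prop :=
  exists B : nat -> set X, (forall n, bounded_by (u n) (B n)) /\
    forall x, T x -> finite_set [set n | ~ B n x].

Lemma hurewicz_on_bigcup (X : Type) (u : nat -> set (set X)) (T : nat -> set X) :
  (forall k, hurewicz_on u (T k)) -> hurewicz_on u (\bigcup_k T k).
Proof.
move=> /choice[B BP]; exists (fun n => \bigcup_(k in `I_n) B k n); split=> [n|x [k _ Tx]].
  by apply: bounded_by_bigcup (finite_II n) _ => k _; case: (BP k).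
have [_ /(_ x Tx) finB] := BP k.
apply: sub_finite_set (_ : _ `<=` `I_k.+1 `|` [set n | ~ B k n x]) _; last first.
  by rewrite finite_setU; split=> //; exact: finite_II.
move=> n /= nB; have [?|kn] := ltnP n k.+1; [by left|right=> Bx].
by apply: nB; exists k.
Qed.

Lemma hurewicz_onU (X : Type) (u : nat -> set (set X)) (A B : set X) :
  hurewicz_on u A -> hurewicz_on u B -> hurewicz_on u (A `|` B).
Proof.
move=> hA hB; have -> : A `|` B = \bigcup_k (if k is 0 then A else B).
  apply/seteqP; split=> x; first by case; [exists 0|exists 1].
  by move=> [[|k] _]; [left|right].
by apply: hurewicz_on_bigcup => -[].
Qed.

Lemma hurewicz_onS (X : Type) (u : nat -> set (set X)) (A B : set X) :
  A `<=` B -> hurewicz_on u B -> hurewicz_on u A.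
Proof. by move=> AB [C [bC BC]]; exists C; split=> // x /AB; exact: BC. Qed.

(** * Colored covers *)

(** The sets containing a given point have different colors, so among any [m + 1]
    of them one has color at least [m] and is bounded by [u m]. *)
Definition colored_cover (X : topologicalType) (u : nat -> set (set X))
    (R : nat -> set X) (col : nat -> nat) : Prop :=
  [/\ forall i, open (R i),
      forall i m, m <= col i -> bounded_by (u m) (R i),
      forall i i' x, R i x -> R i' x -> col i = col i' -> i = i'
    & forall x, infinite_set [set i | R i x]].

(** Colors [2n] and [2n + 1] are the two disjoint families obtained from the
    open sets bounded by each of the covers of index at most [2n + 1]. *)
Lemma colored_cover_exists (X : topologicalType) (u : nat -> set (set X)) :
  paracompact X -> hereditarily_lindelof X -> (forall n, open_cover (u n)) ->
  exists R col, colored_cover u R col.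
Proof.
move=> paraX hlX covu.
pose g n := [set O : set X | open O /\ forall m, m <= n -> bounded_by (u m) O].
have gT n : \bigcup_(O in g n) O = setT.
  apply/seteqP; split=> // x _; elim: n => [|n [O [oO bO] Ox]].
    have [uop uT] := covu 0; have : (\bigcup_(U in u 0) U) x by rewrite uT.
    move=> [U uU Ux]; exists U => //; split=> [|m]; first exact: uop.
    rewrite leqn0 => /eqP ->; exists [set U]; split; first exact: finite_set1.
      by move=> _ ->.
    by move=> y Uy; exists U.
  have [uop uT] := covu n.+1; have : (\bigcup_(U in u n.+1) U) x by rewrite uT.
  move=> [U uU Ux]; exists (O `&` U) => //; split=> [|m].
    by apply: openI => //; exact: uop.
  rewrite leq_eqVlt => /orP[/eqP ->|]; last first.
    by rewrite ltnS => /bO; apply: bounded_byS => y [].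
  exists [set U]; split; first exact: finite_set1.
    by move=> _ ->.
  by move=> y [_ Uy]; exists U.
have gop n : g n `<=` open by move=> O [].
have g0 n : g n set0 by split=> [|m _]; [exact: open0|exact: bounded_by0].
have gU n U V : g n U -> g n V -> g n (U `|` V).
  move=> [oU bU] [oV bV]; split=> [|m mn]; first exact: openU.
  by apply: bounded_byU; [exact: bU|exact: bV].
have [F FP] := choice (fun n => paracompact_two_disjoint_families paraX hlX
  (gop n.*2.+1) (g0 n.*2.+1) (gU n.*2.+1) (gT n.*2.+1)).
pose code i : option (nat * nat) := pickle_inv i.
pose R i := if code i is Some (c, k) then F c./2 (odd c) k else set0.
pose col i := if code i is Some (c, k) then c else 0.
exists R, col; split=> [i|i m|i i' x|x].
- rewrite /R; case: (code i) => [[c k]|]; last exact: open0.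
  by have [oF _ _ _] := FP c./2; exact: oF.
- rewrite /R /col; case: (code i) => [[c k]|] mc; last exact: bounded_by0.
  have [_ /(_ (odd c) k)[U [_ bU] FU] _ _] := FP c./2.
  by apply: bounded_byS FU (bU m _); have := odd_double_half c; lia.
- rewrite /R /col; case ci: (code i) => [[c k]|] //; case ci': (code i') => [[c' k']|] //.
  move=> Fx F'x eqc; rewrite -eqc in ci' F'x.
  have [_ _ disjF _] := FP c./2.
  have eqk := disjF _ _ _ _ Fx F'x; rewrite -eqk in ci'.
  have codeK j ck : code j = Some ck -> j = pickle ck.
    by move=> cj; have := @pickle_invK (nat * nat)%type j; rewrite -/(code j) cj.
  by rewrite (codeK _ _ ci) (codeK _ _ ci').
- move=> finx.
  have [N colN] := (finite_nat_boundedP _).1 (finite_image col finx).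
  have [_ _ _ /(_ x)[b [k Fx]]] := FP N.
  suff /colN : [set col i | i in [set i | R i x]] (b + N.*2) by lia.
  exists (pickle (b + N.*2, k)); rewrite /= /R /col /code pickleK_inv //.
  by rewrite half_bit_double oddD odd_double addbF oddb.
Qed.

(** At stage [m] take the sets [R i] of color at least [m] among the first
    [2m + 1] intervals. A point that is met on every interval from the [m]-th on
    lies in one [R i] for each of the [m + 1] intervals of index [m, ..., 2m]; these
    have distinct colors, one of which is therefore at least [m]. *)
Lemma colored_cover_hurewicz_on (X : topologicalType) (u : nat -> set (set X))
    R col (a : nat -> nat) (T : set X) :
  colored_cover u R col -> (forall j, a j < a j.+1) ->
  (forall x, T x -> exists N, forall j, N <= j ->
     exists2 i, a j <= i < a j.+1 & R i x) ->
  hurewicz_on u T.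
Proof.
move=> [_ bR disjR _] incr Tmet.
pose I m := [set i | i < a m.*2.+1 /\ m <= col i].
exists (fun m => \bigcup_(i in I m) R i); split=> [m|x Tx].
  apply: bounded_by_bigcup => [|i [_ /bR//]].
  by apply: sub_finite_set (finite_II (a m.*2.+1)) => i [].
have [N meetN] := Tmet x Tx.
apply/finite_nat_boundedP; exists N => m nB; rewrite ltnNge; apply/negP => Nm.
have [j|f fP] := @choice 'I_m.+1 nat (fun j i => a (m + j) <= i < a (m + j).+1 /\ R i x).
  by have [|i ? ?] := meetN (m + j); [exact: leq_trans Nm (leq_addr _ _)|exists i].
have colf j : col (f j) < m.
  have [fint Rx] := fP j; rewrite ltnNge; apply/negP => mcol; apply: nB.
  exists (f j) => //; split=> //; have /andP[_ /leq_trans] := fint; apply.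
  by apply: increasing_le => //; have := ltn_ord j; lia.
have inj_col : injective (fun j => Ordinal (colf j)).
  move=> j j' [eqcol]; have [fint Rx] := fP j; have [fint' Rx'] := fP j'.
  have eqf := disjR _ _ _ Rx Rx' eqcol; rewrite -eqf in fint'.
  have := increasing_interval_inj incr fint fint'.
  by move=> /addnI/ord_inj.
by have := leq_card _ inj_col; rewrite !card_ord ltnn.
Qed.

(** * Unsplittable large covers *)

Lemma infinite_image (T U : Type) (f : T -> U) (A : set T) :
  (forall y, finite_set [set x | A x /\ f x = y]) -> infinite_set A ->
  infinite_set (f @` A).
Proof.
move=> fibf; apply: contra_not => finfA.
apply: sub_finite_set (bigcup_finite finfA (fun y _ => fibf y)) => x Ax.
by exists (f x) => //; exists x.
Qed.

Definition block (X : Type) (R : nat -> set X) (A : set nat) (i : nat) : set X :=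
  \bigcup_(i' in [set i' | cut A i' = cut A i]) R i'.

(** The points outside [O] of a set that occurs infinitely often as [O `|` block R
    A i] are met by [R] on infinitely many pieces of the partition [cut A], which can be
    placed in successive intervals. *)
Lemma repeated_block_hurewicz_on (X : topologicalType) (u : nat -> set (set X))
    R col (O W : set X) (A : set nat) :
  colored_cover u R col -> infinite_set A ->
  infinite_set [set i | O `|` block R A i = W] -> hurewicz_on u (W `\` O).
Proof.
move=> colR infA /infinite_nat_unboundedP infK.
pose Q m n := exists2 i, O `|` block R A i = W &
  forall i', cut A i' = cut A i -> m <= i' < n.
have [m|a incr aQ] := @interval_chain Q.
  have [b bP] : exists b, forall i i', i < m -> cut A i' = cut A i -> i' < b.
    elim: m => [|m [b bP]]; first by exists 0.
    have [c cP] := cut_fiber_bounded infA m.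
    exists (maxn b c) => i i'; rewrite ltnS leq_eqVlt leq_max.
    by case/orP=> [/eqP -> /cP ->|/bP/[apply] ->]; rewrite ?orbT.
  have [i Ki bi] := infK b; have [n nP] := cut_fiber_bounded infA i.
  have mi i' : cut A i' = cut A i -> m <= i'.
    move=> eqc; rewrite leqNgt; apply/negP => im.
    by have := bP _ _ im (esym eqc); rewrite ltnNge bi.
  exists n; split; first by apply: leq_ltn_trans (mi i erefl) (nP i erefl).
  by exists i => // i' eqc; rewrite mi // nP.
apply: colored_cover_hurewicz_on colR incr _ => x [Wx nOx]; exists 0 => j _.
have [i eqW fib] := aQ j; move: Wx; rewrite -eqW => -[//|[i' eqc Rx]].
by exists i' => //; exact: fib.
Qed.

(** Here the unsplittable large cover is the family of the [V i]. Adding [O] to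
    each of them makes the cover large at the points of [O], at no cost elsewhere. *)
Lemma split_large_hurewicz_on (X : topologicalType) (u : nat -> set (set X)) :
  u_lt_g -> paracompact X -> hereditarily_lindelof X -> split_large X ->
  (forall n, open_cover (u n)) -> hurewicz_on u setT.
Proof.
move=> u_g paraX hlX splitX covu.
pose h := [set T | open T /\ hurewicz_on u T].
have [||e he eqO] := hereditarily_lindelof_bigcup (g := h) hlX.
- by move=> T [].
- split; first exact: open0.
  by exists (fun=> set0); split=> // n; exact: bounded_by0.
pose O := \bigcup_(T in h) T.
have oO : open O by apply: bigcup_open => T [].
have hO : hurewicz_on u O by rewrite /O eqO; apply: hurewicz_on_bigcup => k; case: (he k).
have maxO T : open T -> hurewicz_on u T -> T `<=` O.
  by move=> oT hT x Tx; exists T.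
have [[z nOz]|Ofull] := pselect (exists z, ~ O z); last first.
  by apply: hurewicz_onS hO => x _; apply: contrapT => nOx; apply: Ofull; exists x.
have [R [col colR]] := colored_cover_exists paraX hlX covu.
have [oR _ _ infR] := colR.
have [F UF swallow] := u_lt_g_swallowing u_g.
(* An interval partition that is not evaded would make the complement of [O] good. *)
have [|A infA FA] := swallow [set [set i | R i x] | x in ~` O].
  move=> a incr; apply: contrapT => noS; apply: nOz.
  suff hT : hurewicz_on u setT by apply: (maxO setT) => //; exact: openT.
  rewrite -(setUv O); apply: hurewicz_onU => //.
  apply: colored_cover_hurewicz_on colR incr _ => x nOx.
  apply: contrapT => noN; apply: noS; exists [set i | R i x]; first by exists x.
  move=> N; apply: contrapT => noj; apply: noN; exists N => j Nj.
  apply: contrapT => noi; apply: noj; exists j => // i iint Rx.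
  by apply: noi; exists i.
pose V i := O `|` block R A i.
have oV i : open (V i) by apply: openU => //; exact: bigcup_open.
have V_cut i i' : cut A i = cut A i' -> V i = V i' by rewrite /V /block => ->.
have RV i x : R i x -> V i x by right; exists i.
(* Otherwise [W] would be good, and contained in [O]. *)
have finV x W : ~ O x -> W x -> finite_set [set i | V i = W].
  move=> nOx Wx; apply: contrapT => infK.
  have [i /= ViW] := infinite_setN0 infK.
  have hW := repeated_block_hurewicz_on colR infA infK.
  apply/nOx/(maxO W) => //; first by rewrite -ViW.
  apply: hurewicz_onS (hurewicz_onU hO hW) => y Wy.
  by have [?|?] := pselect (O y); [left|right].
have largeV : large_open_cover (range V).
  split=> [_ [i _ <-]//|x]; wlog nOx : x / ~ O x => [IH|].
    have [Ox|/IH//] := pselect (O x); apply: sub_infinite_set (IH z nOz).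
    by move=> _ [[i _ <-] _]; split; [exists i|left].
  suff : infinite_set (V @` [set i | V i x]).
    by apply: sub_infinite_set => _ [i Vx <-]; split=> //; exists i.
  apply: infinite_image => [W|]; last by apply: sub_infinite_set (infR x) => i; exact: RV.
  have [Wx|nWx] := pselect (W x).
    by apply: sub_finite_set (finV x W nOx Wx) => i [].
  by apply: sub_finite_set (finite_set0 _) => i [Vx VW]; apply: nWx; rewrite -VW.
have [v1 [v2 [large1 large2 disj sub12]]] := splitX _ largeV.
(* The indices of a large subfamily meet every member of [F]. *)
have hit v E : large_open_cover v -> v `<=` range V -> F E -> exists2 i, E i & v (V i).
  move=> [_ infv] vV /FA[_ [x nOx <-] finS]; apply: contrapT => noi; apply: (infv x).
  apply: sub_finite_set (finite_image V finS) => W [/[dup] vW /vV[i _ ViW] Wx].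
  move: Wx; rewrite -ViW => -[//|[i' eqc Rx]]; exists i'; last exact: V_cut.
  split=> // j Ej eqj; apply: noi; exists j => //.
  by rewrite (V_cut j i) ?ViW // eqj.
have [F1|F1] := in_ultra_setVsetC [set i | v1 (V i)] UF.
- have [|i vi1 vi2] := hit v2 _ large2 _ F1.
    by move=> W v2W; apply: sub12; right.
  suff : set0 (V i) by []; by rewrite -disj.
- have [|i] := hit v1 _ large1 _ F1; last by [].
  by move=> W v1W; apply: sub12; left.
Qed.

Theorem theorem5 (u_g : u_lt_g) (X : topologicalType)
    (paraX : paracompact X) (hlX : hereditarily_lindelof X)
    (splitX : split_large X) :
  hurewicz X.
Proof.
move=> u covu.
have [B [bB finB]] := split_large_hurewicz_on u_g paraX hlX splitX covu.
by exists B; split=> // x; exact: finB.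
Qed.
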